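(* Let $G$ be a connected $3$-colored graph on $n$ vertices. The rank of the c-incidence matrix $J_G$ equals $n$ if and only if $G$ contains an odd cycle or a colored vertex. Otherwise, the rank of $J_G$ is $n-1$.
   Context: Graphs are finite and simple. A $3$-colored graph is a graph $G=(V,E)$ together with a color function $\gamma:V\to\{1,-1,0\}$; a vertex $v$ is colorless if $\gamma(v)=0$ and colored if $\gamma(v)\in\{1,-1\}$. Let $V=\{1,\dots,n\}$ and order the edges. With $\mathbf e_j$ the $j$th standard row vector of $\mathbb R^n$, the c-incidence matrix $J_G$ is the real $(|E|+n)\times n$ matrix whose first $|E|$ rows are $\mathbf e_i+\mathbf e_j$, one for each edge $\{i,j\}\in E$ (the transpose of the unsigned incidence matrix), and whose last $n$ rows are $\gamma(i)\mathbf e_i$, $1\le i\le n$. Rank is taken over $\mathbb R$. *)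

(* Defs.v *)
From HB Require Import structures.
From mathcomp Require Import all_boot all_order all_algebra.
From mathcomp Require Import reals.
Set Implicit Arguments.
Unset Strict Implicit.
Unset Printing Implicit Defensive.
Import Order.TTheory GRing.Theory Num.Theory.
Local Open Scope ring_scope.

(* The vertices 1, ..., n are encoded as 0, ..., n-1 in ['I_n]. *)
Record colored_graph (n : nat) := ColoredGraph {
  adj : rel 'I_n;
  color : 'I_n -> int;
  adj_sym : symmetric adj;
  adj_irrefl : irreflexive adj;
  color_range : forall v, color v \in [:: 1; -1; 0]
}.

Section ColoredGraphs.
Variables (n : nat) (G : colored_graph n).

Definition edges : {set {set 'I_n}} :=
  [set [set x; y] | x in 'I_n, y in 'I_n & adj G x y].

(* As usual, the graph with no vertex is not considered connected. *)
Definition connected : Prop :=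
  (0 < n)%N /\ forall x y : 'I_n, connect (adj G) x y.

(* A cycle is the sequence of its pairwise distinct vertices, at least 3 of
   them: without this bound, [path.cycle] would also accept [::] and [:: x; y]
   for any edge {x, y}. *)
Definition is_cycle (c : seq 'I_n) : Prop :=
  [/\ cycle (adj G) c, uniq c & (3 <= size c)%N].

Definition has_odd_cycle : Prop :=
  exists c : seq 'I_n, is_cycle c /\ odd (size c).

Definition colored (v : 'I_n) : bool := color G v \in [:: 1; -1].

Definition edge_order (s : #|edges|.-tuple {set 'I_n}) : Prop :=
  uniq s /\ s =i edges.

(* The row of an edge {i, j} is the sum of the standard row vectors of its
   elements, that is e_i + e_j (recall that i != j). *)
Definition c_incidence_mx (R : realType) (s : #|edges|.-tuple {set 'I_n}) :
    'M[R]_(#|edges| + n, n) :=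
  col_mx (\matrix_(k < #|edges|) \sum_(i in tnth s k) delta_mx 0 i)
         (\matrix_(i < n) ((color G i)%:~R *: delta_mx 0 i)).

End ColoredGraphs.

(* Main.v *)
(* A vector u lies in the kernel of J_G iff u x = - u y along every edge xy and
   u vanishes on the colored vertices.  On a connected graph such a u is
   determined by its value at one vertex, so the kernel has dimension at most 1.
   Going around an odd cycle gives u x = - u x, so an odd cycle or a colored
   vertex kills the kernel.  Without them every closed walk is even, and the
   parity of walks from a base vertex is a well-defined sign vector spanning
   the kernel. *)
Require Import Defs.
From mathcomp Require Import all_boot all_order all_algebra.
From mathcomp Require Import boolp reals.
Set Implicit Arguments.
Unset Strict Implicit.
Unset Printing Implicit Defensive.
Import Order.TTheory GRing.Theory Num.Theory.
Local Open Scope ring_scope.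

Lemma not_uniq_split (T : eqType) (c : seq T) : ~~ uniq c ->
  exists x p1 p2 p3, c = p1 ++ x :: p2 ++ x :: p3.
Proof.
elim: c => //= x c IHc; rewrite negb_and negbK => /orP[xc | /IHc].
  by case/splitPr: xc => p2 p3; exists x, [::], p2, p3.
by move=> [y [p1 [p2 [p3 ->]]]]; exists y, (x :: p1), p2, p3.
Qed.

Lemma odd_closed_walk_cycle (T : eqType) (e : rel T) (c : seq T) :
    cycle e c -> odd (size c) ->
  exists c', [/\ cycle e c', uniq c' & odd (size c')].
Proof.
have [k] := ubnP (size c); elim: k c => // k IHk c lt_ck c_cycle c_odd.
have [c_uniq | ] := boolP (uniq c); first by exists c.
(* Cutting at a repeated vertex leaves two shorter closed walks, of which
   exactly one is odd. *)
move=> /not_uniq_split[x [p1 [p2 [p3 Dc]]]].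
have rotE : rot (size p1) c = (x :: p2) ++ (x :: p3 ++ p1).
  by rewrite Dc rot_size_cat /= -catA.
have szE : size c = (size (x :: p2) + size (x :: p3 ++ p1))%N.
  by rewrite -size_cat -rotE size_rot.
have [cyc1 cyc2] : cycle e (x :: p2) /\ cycle e (x :: p3 ++ p1).
  move: c_cycle; rewrite -(rot_cycle (size p1)) rotE /= rcons_cat cat_path /=.
  by rewrite !rcons_path => /and3P[-> -> ].
rewrite ltnS szE in lt_ck; rewrite szE oddD in c_odd.
have [odd1 | even1] := boolP (odd (size (x :: p2))).
  by apply: IHk cyc1 odd1; apply: leq_trans lt_ck; rewrite -addn1 leq_add2l.
apply: IHk cyc2 _; first by apply: leq_trans lt_ck; rewrite -add1n leq_add2r.
by move: c_odd; rewrite (negPf even1).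
Qed.

(** Each step of the walk flips the sign of [f], so only the parity of the number of steps
    survives. *)
Lemma alternating_path (V : zmodType) (T : Type) (e : rel T) (f : T -> V) :
    (forall x y, e x y -> f x + f y = 0) ->
  forall x p, path e x p ->
    f (last x p) = if odd (size p) then - f x else f x.
Proof.
move=> fe x p; elim: p x => //= y p IHp x /andP[/fe/eqP fxy /IHp->].
by move: fxy; rewrite addrC addr_eq0 => /eqP ->; case: odd; rewrite //= opprK.
Qed.

Section ColoredGraph.
Variables (n : nat) (G : colored_graph n).
Implicit Types (c p q : seq 'I_n) (x y : 'I_n).

Lemma odd_closed_walk_has_odd_cycle c :
  cycle (adj G) c -> odd (size c) -> has_odd_cycle G.
Proof.
move=> c_cyc /(odd_closed_walk_cycle c_cyc)[c' [cyc uniq_c odd_c]].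
exists c'; split=> //; split=> //.
(* An odd size below 3 is 1, and a closed walk on one vertex would be a loop. *)
by case: c' cyc odd_c {uniq_c} => [|x [|y [|]]] //=; rewrite adj_irrefl.
Qed.

Lemma walks_to_neighbours x p q :
    ~ has_odd_cycle G -> path (adj G) x p -> path (adj G) x q ->
  adj G (last x p) (last x q) -> odd (size p) = ~~ odd (size q).
Proof.
move=> no_odd pP qP pq.
have [eq_odd | ] := eqVneq (odd (size p)) (odd (size q)); last by do 2!case: odd.
case: no_odd.
have qR : path (adj G) (last x q) (rev (belast x q)).
  by rewrite rev_path (eq_path (e' := adj G)) // => y z; rewrite adj_sym.
(* Follow [p] from [x], cross the edge, and come back along [q]; the closing step returns to [x].
   The length is [size p + size q + 1], odd when the two parities agree. *)
apply: (@odd_closed_walk_has_odd_cycle (x :: p ++ rev q)).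
  by rewrite /= rcons_cat -rev_cons lastI rev_rcons cat_path /= pP pq.
by rewrite /= size_cat size_rev oddD eq_odd addbb.
Qed.

Lemma alternating_connected (V : zmodType) (f : 'I_n -> V) x y :
    (forall x y, adj G x y -> f x + f y = 0) ->
  connected G -> f x = 0 -> f y = 0.
Proof.
move=> f_alt [_ /(_ x y)/connectP[p pP ->]] fx0.
by rewrite (alternating_path f_alt pP) fx0 oppr0 if_same.
Qed.

Lemma alternating_odd_cycle (R : numDomainType) (f : 'I_n -> R) :
    (forall x y, adj G x y -> f x + f y = 0) ->
  has_odd_cycle G -> exists x, f x = 0.
Proof.
move=> f_alt [[|x c] [[c_cyc _ _] c_odd]] //; exists x.
(* Once around, the walk makes as many steps as the cycle has vertices, so [f x = - f x]; then
   [f x *+ 2 = 0], and the characteristic is 0. *)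
have := alternating_path f_alt c_cyc; rewrite last_rcons size_rcons.
by rewrite [odd _]c_odd => /eqP; rewrite -addr_eq0 -mulr2n mulrn_eq0 => /eqP.
Qed.

Lemma exists_sign_vector (R : pzRingType) (x0 : 'I_n) :
    connected G -> ~ has_odd_cycle G ->
  exists f : 'I_n -> R, f x0 = 1 /\ forall x y, adj G x y -> f x + f y = 0.
Proof.
move=> [_ conn] no_odd.
have /fin_all_exists[w wP] x :
    exists p, path (adj G) x0 p /\ x = last x0 p.
  by have /connectP[p pP ->] := conn x0 x; exists p.
(* The chosen walk [w x0] from [x0] to itself may be nonempty; the constant second factor normalises
   the value at [x0] to 1. *)
exists (fun x => (-1) ^+ odd (size (w x)) * (-1) ^+ odd (size (w x0))).
split=> [|x y xy]; first by rewrite -expr2 sqrr_sign.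
have [[px ex] [py ey]] := (wP x, wP y).
have -> : odd (size (w x)) = ~~ odd (size (w y)).
  by apply: walks_to_neighbours no_odd px py _; rewrite -ex -ey.
by rewrite signrN mulNr addNr.
Qed.

End ColoredGraph.

Section Rank.
Variables (R : realType) (n : nat) (G : colored_graph n).
Variables (s : #|edges G|.-tuple {set 'I_n}) (hs : edge_order s).

(** Matrix kernels here act on row vectors, hence the transpose. The block [A] of edge rows yields
    the sums along edges, the block [B] the products of colors with entries of [u]. *)
Lemma c_incidence_kernelP (u : 'rV[R]_n) :
  u *m (c_incidence_mx R s)^T = 0 <->
    (forall x y, adj G x y -> u 0 x + u 0 y = 0) /\
    (forall v, colored G v -> u 0 v = 0).
Proof.
have deltaE i : ((delta_mx 0 i : 'rV_n) *m u^T) 0 0 = u 0 i by rewrite -rowE !mxE.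
pose A : 'M[R]_(#|edges G|, n) := \matrix_k \sum_(i in tnth s k) delta_mx 0 i.
pose B : 'M[R]_n := \matrix_i ((color G i)%:~R *: delta_mx 0 i).
have AE k : (A *m u^T) k 0 = \sum_(i in tnth s k) u 0 i.
  transitivity (row k (A *m u^T) 0 0); first by rewrite [RHS]mxE.
  rewrite row_mul rowK mulmx_suml summxE.
  by apply: eq_bigr => i _; exact: deltaE.
have BE i : (B *m u^T) i 0 = (color G i)%:~R * u 0 i.
  transitivity (row i (B *m u^T) 0 0); first by rewrite [RHS]mxE.
  by rewrite row_mul rowK -scalemxAl mxE deltaE.
have edgeE x y : adj G x y -> \sum_(i in [set x; y]) u 0 i = u 0 x + u 0 y.
  move=> xy; rewrite big_setU1 ?big_set1 // inE.
  by apply: contraTneq xy => ->; rewrite adj_irrefl.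
have -> : u *m (c_incidence_mx R s)^T = (col_mx (A *m u^T) (B *m u^T))^T.
  by rewrite -mul_col_mx trmx_mul trmxK.
have [_ s_edges] := hs.
split=> [/(congr1 trmx)/eqP | [u_alt u_col]].
  rewrite trmxK trmx0 col_mx_eq0 => /andP[/eqP A0 /eqP B0].
  split=> [x y xy | v].
    have : [set x; y] \in s by rewrite s_edges; apply/imset2P; exists x y; rewrite ?inE.
    by case/tnthP=> k Ek; rewrite -edgeE // Ek -AE A0 mxE.
  move=> v_col; have /eqP := BE v; rewrite B0 mxE eq_sym mulf_eq0 intr_eq0.
  by case/orP=> /eqP // v0; move: v_col; rewrite /colored v0.
rewrite (_ : col_mx _ _ = 0) ?trmx0 //; apply/eqP; rewrite col_mx_eq0.
apply/andP; split; apply/eqP/matrixP => k j; rewrite ord1 [RHS]mxE.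
  rewrite AE; have := mem_tnth k s; rewrite s_edges => /imset2P[x y _].
  by rewrite inE => /andP[_ xy] ->; rewrite edgeE ?u_alt.
rewrite BE; have := color_range G k; rewrite !inE orbA => /orP[k_col | /eqP ->].
  by rewrite u_col ?mulr0 // /colored !inE.
by rewrite mul0r.
Qed.

Lemma rank_c_incidence_full :
    connected G -> has_odd_cycle G \/ (exists v, colored G v) ->
  \rank (c_incidence_mx R s) = n.
Proof.
move=> conn odd_or_col; rewrite -mxrank_tr; apply/eqP.
apply: inj_row_free => u /c_incidence_kernelP[u_alt u_col].
have [x ux0] : exists x, u 0 x = 0.
  case: odd_or_col => [/(alternating_odd_cycle u_alt) // | [v v_col]].
  by exists v; apply: u_col.
apply/rowP => y; rewrite mxE.
exact: (alternating_connected y (f := u 0) u_alt conn ux0).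
Qed.

Lemma rank_c_incidence_deficient :
    connected G -> ~ has_odd_cycle G -> ~ (exists v, colored G v) ->
  \rank (c_incidence_mx R s) = (n - 1)%N.
Proof.
move=> conn no_odd no_col; have [n_gt0 _] := conn; pose x0 := Ordinal n_gt0.
have [f [fx0 f_alt]] := exists_sign_vector R x0 conn no_odd.
pose u : 'rV_n := \row_x f x.
have u_ker : (u <= kermx (c_incidence_mx R s)^T)%MS.
  apply/sub_kermxP/c_incidence_kernelP; split=> [x y xy | v v_col].
    by rewrite !mxE f_alt.
  by case: no_col; exists v.
have ker_u : (kermx (c_incidence_mx R s)^T <= u)%MS.
  apply/rV_subP => w /sub_kermxP/c_incidence_kernelP[w_alt _].
  apply/sub_rVP; exists (w 0 x0); apply/rowP => y; rewrite !mxE; apply/eqP.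
  (* The difference [g] is again alternating and vanishes at [x0], hence everywhere by
     connectedness. *)
  rewrite -subr_eq0; apply/eqP; pose g x := w 0 x - w 0 x0 * f x.
  apply: (alternating_connected (f := g) (x := x0) y _ conn) => [x z xz|].
    by rewrite /g addrACA -opprD -mulrDr f_alt // mulr0 subr0 w_alt.
  by rewrite /g fx0 mulr1 subrr.
have rank_u : \rank u = 1%N.
  rewrite rank_rV; case: eqP => // /rowP/(_ x0)/eqP.
  by rewrite !mxE fx0 oner_eq0.
have := mxrank_ker (c_incidence_mx R s)^T; rewrite mxrank_tr.
have /eqmxP-> : (kermx (c_incidence_mx R s)^T == u)%MS.
  by rewrite ker_u.
(* Rank-nullity reads [1 = n - rank] in truncated subtraction; the bound [rank <= n] allows solving
   for the rank. *)
by rewrite rank_u => ->; rewrite subKn // rank_leq_col.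
Qed.

End Rank.

Theorem theorem1 (R : realType) (n : nat) (G : colored_graph n)
    (s : #|edges G|.-tuple {set 'I_n}) (hs : edge_order s)
    (hG : connected G) :
  (\rank (c_incidence_mx R s) = n
     <-> has_odd_cycle G \/ (exists v : 'I_n, colored G v)) /\
  (~ (has_odd_cycle G \/ (exists v : 'I_n, colored G v)) ->
     \rank (c_incidence_mx R s) = (n - 1)%N).
Proof.
have deficient : ~ (has_odd_cycle G \/ (exists v, colored G v)) ->
    \rank (c_incidence_mx R s) = (n - 1)%N.
  by move=> /not_orP[]; apply: rank_c_incidence_deficient.
split=> //; split; last exact: rank_c_incidence_full.
move=> rank_n; apply: contrapT => /deficient.
(* The equation [n = n - 1] is absurd only for positive [n], which the definition of connectedness
   provides. *)
have [n_gt0 _] := hG; rewrite rank_n subn1 => /eqP.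
by rewrite -[X in X == _](prednK n_gt0) eqn_leq ltnn.
Qed.
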